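(* Let a system have microstates $\{\mathfrak m_k\}$ with microstate energies $E_k(\mathbf W)$ that are differentiable functions of a work parameter $\mathbf W\in\mathbb R^n$, and consider an arbitrary macrostate evolving in time, i.e. differentiable functions $t\mapsto \mathbf W(t)$ and $t\mapsto p_k(t)\ge 0$ with $\sum_k p_k(t)=1$. Split the change of the average energy $E(t)=\sum_k p_k(t)E_k(\mathbf W(t))$ as $dE=dE_{\rm m}+dE_{\rm s}$, where the isentropic contribution is $dE_{\rm m}=\sum_k p_k\,dE_k$ (change at fixed probabilities) and the stochastic contribution is $dE_{\rm s}=\sum_k E_k\,dp_k$ (change at fixed microstate energies). Then the isentropic contribution represents the generalized macrowork $dW$ and the stochastic contribution represents the generalized macroheat $dQ$: $$dW(t)=-dE_{\rm m}(t)=-\sum_k p_k(t)\,dE_k(t),\qquad dQ(t)=dE_{\rm s}(t)=\sum_k E_k(t)\,dp_k(t).$$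
   Context: Microstates form a countable set indexed by $k$. The energy $E_k$ of $\mathfrak m_k$ depends only on the parameter $\mathbf W$ (the same $\mathbf W$ for all microstates). The macrostate at time $t$ is the collection $\{\mathfrak m_k,p_k(t)\}$; no equilibrium assumption is made on $\{p_k\}$. All differentials are along the process, $dY=\dot Y(t)\,dt$; sums over $k$ are assumed to converge and to be differentiable term by term (automatic for finitely many microstates). The generalized microforce is $\mathbf F_{{\rm w}k}=-\partial E_k/\partial\mathbf W$ and the generalized macroforce is its ensemble average $\mathbf F_{\rm w}=\sum_k p_k\mathbf F_{{\rm w}k}$. The generalized macrowork done by the system is defined mechanically (force times displacement) by $dW=\mathbf F_{\rm w}\cdot d\mathbf W$. The generalized macroheat $dQ$ is the quantity defined by the first law $dE=dQ-dW$. *)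

(* Defs.v *)
From HB Require Import structures.
From mathcomp Require Import all_boot all_order all_algebra.
From mathcomp Require Import all_classical all_reals all_analysis.

Set Implicit Arguments.
Unset Strict Implicit.
Unset Printing Implicit Defensive.

Import Order.TTheory GRing.Theory Num.Theory.
Import numFieldNormedType.Exports.

Local Open Scope ring_scope.

Section CountableSums.
Context {R : realType} {K : countType} {V : normedModType R}.
Implicit Type f : K -> V.

(* Partial sums along the enumeration of K given by [pickle]; integers that
   code no element of K contribute 0, so a finite K gives its finite sum.
   Convergence may be conditional: absolute convergence is not required. *)
Definition cpartial_sums f : nat -> V :=
  series (fun n => oapp f 0 (pickle_inv n)).

Definition csummable f : Prop := cvgn (cpartial_sums f).

Definition csum f : V := limn (cpartial_sums f).

End CountableSums.

Definition termwise_derivable (R : realType) (K : countType)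
    (f : K -> R -> R) (t : R) : Prop :=
  csummable (fun k => derive1 (f k) t) /\
  is_derive t 1 (fun s => csum (fun k => f k s)) (csum (fun k => derive1 (f k) t)).

Definition dotp (R : realType) (n : nat) (u v : 'rV[R]_n) : R :=
  \sum_(i < n) u 0 i * v 0 i.

(* The vector of partial derivatives of f at w. *)
Definition gradient (R : realType) (n : nat) (f : 'rV[R]_n -> R)
    (w : 'rV[R]_n) : 'rV[R]_n :=
  \row_(i < n) 'D_(delta_mx 0 i) f w.

Section Thermodynamics.
Context {R : realType} {n : nat} {K : countType}.
Variables (En : K -> 'rV[R]_n -> R) (p : K -> R -> R) (W : R -> 'rV[R]_n).

Definition microforce (k : K) (w : 'rV[R]_n) : 'rV[R]_n := - gradient (En k) w.

Definition macroforce (t : R) : 'rV[R]_n :=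
  csum (fun k => p k t *: microforce k (W t)).

Definition avg_energy (t : R) : R := csum (fun k => p k t * En k (W t)).

(* All differentials are taken along the process, dY = Y'(t) dt; each of the
   following is the coefficient of dt in the corresponding differential. *)
Definition macrowork_rate (t : R) : R := dotp (macroforce t) (derive1 W t).

(* The first law dE = dQ - dW, solved for the quantity dQ it defines; W is the
   work done by the system. *)
Definition macroheat_rate (t : R) : R := derive1 avg_energy t + macrowork_rate t.

Definition isentropic_term (t : R) (k : K) : R :=
  p k t * derive1 (fun s => En k (W s)) t.

Definition stochastic_term (t : R) (k : K) : R := En k (W t) * derive1 (p k) t.

Definition isentropic_rate (t : R) : R := csum (isentropic_term t).

Definition stochastic_rate (t : R) : R := csum (stochastic_term t).

End Thermodynamics.

(* Main.v *)
(** Since [dotp] is linear and continuous in its first argument, it commutes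
    with the convergent sum defining the macroforce; by the chain rule this
    turns the macrowork into minus the isentropic sum.  The product rule then
    identifies the stochastic sum as the difference of two convergent sums. *)
Require Import Defs.
From HB Require Import structures.
From mathcomp Require Import all_boot all_order all_algebra.
From mathcomp Require Import all_classical all_reals all_analysis.
From mathcomp Require Import ring.

Set Implicit Arguments.
Unset Strict Implicit.
Unset Printing Implicit Defensive.

Import Order.TTheory GRing.Theory Num.Theory.
Import numFieldNormedType.Exports.

Local Open Scope ring_scope.

(** Integers that code no element of [K] contribute 0, and a linear map fixes 0; so the identity
    holds at every finite stage. *)
Lemma cpartial_sums_linear (R : realType) (K : countType)
    (U V : normedModType R) (L : {linear U -> V}) (f : K -> U) :
  cpartial_sums (L \o f) = L \o cpartial_sums f.
Proof.
apply/funext => m; rewrite /cpartial_sums /series /= raddf_sum.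
by apply: eq_bigr => i _; case: pickle_inv => [k|] //=; rewrite raddf0.
Qed.

Lemma cvg_csum_linear (R : realType) (K : countType)
    (U V : normedModType R) (L : {linear U -> V}) (f : K -> U) :
  continuous L -> csummable f ->
  (cpartial_sums (L \o f) @ \oo --> L (csum f))%classic.
Proof.
move=> cL cf; rewrite cpartial_sums_linear.
exact: continuous_cvg (cL _) cf.
Qed.

Lemma cpartial_sumsB (R : realType) (K : countType) (V : normedModType R)
    (f g : K -> V) :
  cpartial_sums (fun k => f k - g k) = cpartial_sums f - cpartial_sums g.
Proof.
apply/funext => m; rewrite /cpartial_sums /series /= !fctE -sumrB.
by apply: eq_bigr => i _; case: pickle_inv => [k|] //=; rewrite subr0.
Qed.

Lemma cvg_csumB (R : realType) (K : countType) (V : normedModType R)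
    (f g : K -> V) :
  csummable f -> csummable g ->
  (cpartial_sums (fun k => f k - g k) @ \oo --> csum f - csum g)%classic.
Proof. by move=> cf cg; rewrite cpartial_sumsB; apply: cvgB. Qed.

(** The arguments are swapped so that [dotpl v] is a function of the force alone and can carry a
    linear structure. *)
Definition dotpl (R : realType) (n : nat) (v u : 'rV[R]_n) : R := dotp u v.

Lemma dotpl_linear (R : realType) (n : nat) (v : 'rV[R]_n) : linear (dotpl v).
Proof.
move=> a x y; rewrite /dotpl /dotp scaler_sumr -big_split /=.
by apply: eq_bigr => i _; rewrite !mxE mulrDl -mulrA.
Qed.

HB.instance Definition _ (R : realType) (n : nat) (v : 'rV[R]_n) :=
  GRing.isLinear.Build R 'rV[R]_n R _ (dotpl v) (dotpl_linear v).

Lemma dotpl_continuous (R : realType) (n : nat) (v : 'rV[R]_n) :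
  continuous (dotpl v).
Proof.
apply: continuous_big => [|i _ u]; first exact: add_continuous.
exact: (@cvgMr_tmp _ _ (nbhs u) _ (fun x : 'rV[R]_n => x 0 i) _ _
  (@coord_continuous R 1 n 0 i u)).
Qed.

Lemma derive1_comp_gradient (R : realType) (n : nat)
    (f : 'rV[R]_n -> R) (W : R -> 'rV[R]_n) (t : R) :
  differentiable f (W t) -> derivable W t 1 ->
  derivable (fun s => f (W s)) t 1 /\
  derive1 (fun s => f (W s)) t = dotp (gradient f (W t)) (derive1 W t).
Proof.
move=> df /derivable1_diffP dW.
have dfW : differentiable (f \o W) t by exact: differentiable_comp.
split; first by apply/derivable1_diffP.
rewrite !derive1E (deriveE _ dfW) (deriveE _ dW) diff_comp //=.
(* Expand the velocity in the standard basis: the differential of [f] sends each basis vector to a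
   partial derivative. *)
rewrite [in LHS](row_sum_delta ('d W t 1)) linear_sum.
by apply: eq_bigr => i _; rewrite linearZ /= mxE deriveE // mulrC.
Qed.

Theorem theorem24 (R : realType) (n : nat) (K : countType)
    (En : K -> 'rV[R]_n -> R) (p : K -> R -> R) (W : R -> 'rV[R]_n)
    (En_diff : forall k w, differentiable (En k) w)
    (W_diff : forall t, derivable W t 1)
    (p_diff : forall k t, derivable (p k) t 1)
    (p_ge0 : forall k t, 0 <= p k t)
    (p_summable : forall t, csummable (fun k => p k t))
    (p_sum1 : forall t, csum (fun k => p k t) = 1)
    (energy_summable : forall t, csummable (fun k => p k t * En k (W t)))
    (energy_termwise : forall t,
       termwise_derivable (fun k s => p k s * En k (W s)) t)
    (force_summable : forall t,
       csummable (fun k => p k t *: microforce En k (W t))) :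
  forall t : R,
    [/\ csummable (isentropic_term En p W t),
        csummable (stochastic_term En p W t),
        derive1 (avg_energy En p W) t
          = isentropic_rate En p W t + stochastic_rate En p W t,
        macrowork_rate En p W t = - isentropic_rate En p W t
      & macroheat_rate En p W t = stochastic_rate En p W t].
Proof.
move=> t.
have chain k := derive1_comp_gradient (En_diff k _) (W_diff t).
(* The microforce is minus the gradient, so pairing it with the reversed velocity restores the sign
   of the chain rule. *)
have isoE : isentropic_term En p W t =
    dotpl (- derive1 W t) \o (fun k => p k t *: microforce En k (W t)).
  apply/funext => k; rewrite /isentropic_term (chain k).2 /dotpl /dotp mulr_sumr.
  by apply: eq_bigr => i _; rewrite !mxE /=; ring.
have iso_cvg :=
  cvg_csum_linear (@dotpl_continuous _ _ (- derive1 W t)) (force_summable t).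
rewrite -isoE in iso_cvg.
(* Convergence of the isentropic sum is inherited from that of the macroforce. *)
have iso_sum : csummable (isentropic_term En p W t) by exact: cvgP iso_cvg.
have isoR : isentropic_rate En p W t =
    dotpl (- derive1 W t) (macroforce En p W t).
  exact: cvg_lim iso_cvg.
have [dE_sum dE] := energy_termwise t.
(* [e k] is the full derivative at [t] of the energy contribution of microstate [k]. *)
set e := (fun k => derive1 _ t) in dE_sum dE.
(* The product rule is solved for the stochastic term, since convergence is known for the other two
   families. *)
have stoE : stochastic_term En p W t =
    fun k => e k - isentropic_term En p W t k.
  apply/funext => k; rewrite /e /isentropic_term /stochastic_term !derive1E.
  have /= -> := deriveM (p_diff k t) (chain k).1.
  by rewrite addrAC subrr add0r.
have sto_cvg := cvg_csumB dE_sum iso_sum.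
rewrite -stoE in sto_cvg.
have stoR : stochastic_rate En p W t = csum e - isentropic_rate En p W t.
  exact: cvg_lim sto_cvg.
have avgE : derive1 (avg_energy En p W) t = csum e.
  (* [derive_val] finds [dE], the termwise differentiation at [t], by instance resolution. *)
  by rewrite derive1E; exact: derive_val.
have workE : macrowork_rate En p W t = - isentropic_rate En p W t.
  rewrite isoR /macrowork_rate /dotpl /dotp -sumrN.
  by apply: eq_bigr => i _; rewrite !mxE mulrN opprK.
split.
- exact: iso_sum.
- exact: cvgP sto_cvg.
- by rewrite avgE stoR addrC subrK.
- exact: workE.
(* Adding the work to the energy change cancels the isentropic part, so only the stochastic sum
   remains. *)
- by rewrite /macroheat_rate avgE workE stoR.
Qed.
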